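(* For every $\eta>1$, $$\lim_{N\to\infty}\sum_{n=2}^N a_n\frac{(\eta-1)^n}{\eta^{n-1}}=G(\eta).$$
   Context: Let $g:(-\pi^2,\infty)\to(0,\infty)$, $g(r)=\sinh(\sqrt r)/\sqrt r$ for $r>0$, $g(0)=1$, $g(r)=\sin(\sqrt{-r})/\sqrt{-r}$ for $-\pi^2<r<0$; it is a strictly increasing bijection with inverse $g^{-1}$. For $\eta>0$ define $G(\eta)=2\eta-2\,\mathrm{sgn}\big(4g^{-1}(\eta^{-1})+\pi^2\big)\sqrt{\eta^2+g^{-1}(\eta^{-1})}+g^{-1}(\eta^{-1})$ (the sign equals $1$ for $\eta<\pi/2$, $0$ at $\eta=\pi/2$, $-1$ for $\eta>\pi/2$). The coefficients $a_n$, $n\ge2$, are determined recursively by requiring that for each $n\ge 2$ the $n$-th right derivative at $\eta=1$ of $G$ equals that of $\sum_{k=2}^n a_k(\eta-1)^k/\eta^{k-1}$; equivalently, $a_n$ is the $n$-th Taylor coefficient at $\xi=0$ of $F(\xi)=(1-\xi)G\big(\frac1{1-\xi}\big)$ (so that $F(\xi)=\sum_{n\ge2}a_n\xi^n$ near $0$). *)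

(* Defs.v *)
From Stdlib Require Import Reals Lra ClassicalEpsilon.
From Coquelicot Require Import Coquelicot.
Open Scope R_scope.

(* g : (-pi^2, oo) -> (0, oo) *)
Definition g (r : R) : R :=
  if Rlt_dec 0 r then sinh (sqrt r) / sqrt r
  else if Req_EM_T r 0 then 1
  else sin (sqrt (- r)) / sqrt (- r).

(* g^{-1}: the (unique, since g is a strictly increasing bijection)
   r in (-pi^2, oo) with g r = y. *)
Definition ginv (y : R) : R :=
  epsilon (inhabits 0) (fun r => - PI ^ 2 < r /\ g r = y).

Definition sgn (x : R) : R :=
  if Rlt_dec 0 x then 1 else if Rlt_dec x 0 then -1 else 0.

Definition G (eta : R) : R :=
  2 * eta - 2 * sgn (4 * ginv (/ eta) + PI ^ 2) * sqrt (eta ^ 2 + ginv (/ eta))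
  + ginv (/ eta).

Definition F (xi : R) : R := (1 - xi) * G (/ (1 - xi)).

Definition a (n : nat) : R := Derive_n F n 0 / INR (Stdlib.Arith.Factorial.fact n).

(* Main.v *)
Require Import Defs.
From Stdlib Require Import Reals Factorial Lra Lia ClassicalEpsilon Ranalysis5.
From Coquelicot Require Import Coquelicot.
Open Scope R_scope.

(* All derivatives of [F] are nonnegative on [[0, 1)], so Bernstein's theorem on
   absolutely monotone functions gives the convergence of its Taylor series there;
   the point [eta] corresponds to [xi = 1 - 1 / eta].

   Put s(u) = sin (sqrt u) / sqrt u = g(-u), an entire function with
   4 u s'' + 6 s' + s = 0, and let u(xi) = - g^{-1}(1 - xi), so that
   s(u(xi)) = 1 - xi and u maps [[0, 1)] into [[0, PI ^ 2)]. The sign in [G] is the sign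
   of cos (sqrt u), whence F = 2 - 2 cos (sqrt u) - u s(u), and the differential equation
   yields F' = u. Moreover u' = Phi(u) with Phi = - 1 / s' and Phi' = p Phi with
   p = - s'' / s'. So it suffices that p is absolutely monotone on [[0, PI ^ 2)]. It
   satisfies the Riccati equation 2 u p' + 5 p = 1/2 + 2 u p^2; differentiating it,
   each derivative of p solves a linear first-order equation, singular at 0, whose
   source term involves lower derivatives with nonnegative coefficients only. *)

(** * Mean value tools *)

Lemma derive_MVT (f df : R -> R) (x y : R) :
  x < y -> (forall t, x <= t <= y -> is_derive f t (df t)) ->
  exists c, f y - f x = df c * (y - x) /\ x < c < y.
Proof.
  intros Hxy Hd. apply MVT_cor2; trivial. intros t Ht. now apply is_derive_Reals, Hd.
Qed.

Lemma derive_nonneg_le (f df : R -> R) (x y : R) :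
  x <= y -> (forall t, x <= t <= y -> is_derive f t (df t)) ->
  (forall t, x <= t <= y -> 0 <= df t) -> f x <= f y.
Proof.
  intros [Hxy| ->] Hd Hp; [|lra].
  destruct (derive_MVT f df x y Hxy Hd) as (c & E & Hc).
  specialize (Hp c ltac:(lra)). nra.
Qed.

(** * Absolutely monotone functions *)

(* With [lo = b] the sign condition is void, so [absmon b b n f] only says that
   [f] is [n] times differentiable below [b]. *)
Fixpoint absmon (lo b : R) (n : nat) (f : R -> R) : Prop :=
  (forall x, lo <= x < b -> 0 <= f x) /\
  match n with
  | O => True
  | S m => exists f', (forall x, x < b -> is_derive f x (f' x)) /\ absmon lo b m f'
  end.

Lemma absmon_pred lo b n f : absmon lo b (S n) f -> absmon lo b n f.
Proof.
  revert f. induction n as [|n IH]; intros f [H0 (f' & Hd & H)]; split; trivial.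
  exists f'. split; trivial. now apply IH.
Qed.

Lemma absmon_ext lo b n f h :
  (forall x, x < b -> f x = h x) -> absmon lo b n f -> absmon lo b n h.
Proof.
  intros E. destruct n as [|n]; intros [H0 H]; split; trivial.
  - intros x Hx. rewrite <- E by lra. auto.
  - intros x Hx. rewrite <- E by lra. auto.
  - destruct H as (f' & Hd & H). exists f'. split; trivial.
    intros x Hx. apply is_derive_ext_loc with f; auto.
    apply (open_lt b x) in Hx. revert Hx. apply filter_imp, E.
Qed.

(** Allows differentiating both sides of an identity that holds only below [b]: the half-line is
    open, so the sides agree near [x]. *)
Lemma is_derive_unique_below (b : R) (f h : R -> R) (x l l' : R) :
  (forall t, t < b -> f t = h t) -> x < b -> is_derive f x l -> is_derive h x l' -> l = l'.
Proof.
  intros E Hx Hf Hh. rewrite <- (is_derive_unique _ _ _ Hf), <- (is_derive_unique _ _ _ Hh).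
  apply Derive_ext_loc. apply (open_lt b x) in Hx. revert Hx. apply filter_imp, E.
Qed.

Lemma absmon_derive lo b n f f' :
  (forall x, x < b -> is_derive f x (f' x)) -> absmon lo b (S n) f -> absmon lo b n f'.
Proof.
  intros Hd [_ (h & Hd' & H)]. apply absmon_ext with h; trivial.
  intros x Hx. apply is_derive_unique_below with b f f x; auto.
Qed.

Lemma absmon_const lo b n c : 0 <= c -> absmon lo b n (fun _ => c).
Proof.
  revert c. induction n as [|n IH]; intros c Hc; split; trivial.
  exists (fun _ => 0). split; [intros x _; apply (is_derive_const c)|]. apply IH. lra.
Qed.

Lemma absmon_plus lo b n f h :
  absmon lo b n f -> absmon lo b n h -> absmon lo b n (fun x => f x + h x).
Proof.
  revert f h. induction n as [|n IH]; intros f h [Hf Hf1] [Hh Hh1]; split; trivial.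
  1, 2: intros x Hx; specialize (Hf x Hx); specialize (Hh x Hx); lra.
  destruct Hf1 as (f' & Df & Hf1), Hh1 as (h' & Dh & Hh1).
  exists (fun x => f' x + h' x). split; [|now apply IH].
  intros x Hx. now apply (is_derive_plus f h); auto.
Qed.

Lemma absmon_mult lo b n f h :
  absmon lo b n f -> absmon lo b n h -> absmon lo b n (fun x => f x * h x).
Proof.
  revert f h. induction n as [|n IH]; intros f h Hf0 Hh0;
    destruct (Hf0) as [Hf Hf1], (Hh0) as [Hh Hh1]; split; trivial.
  1, 2: intros x Hx; apply Rmult_le_pos; auto.
  destruct Hf1 as (f' & Df & Hf1), Hh1 as (h' & Dh & Hh1).
  exists (fun x => f' x * h x + f x * h' x). split.
  - intros x Hx. apply (is_derive_mult f h); auto. exact Rmult_comm.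
  - apply absmon_plus; apply IH; trivial; now apply absmon_pred.
Qed.

(** The chain and product rules only ever produce sums of products of nonnegative derivatives. *)
Lemma absmon_comp lo b lo' b' n f h :
  (forall x, x < b' -> h x < b) -> (forall x, lo' <= x < b' -> lo <= h x) ->
  absmon lo b n f -> absmon lo' b' n h -> absmon lo' b' n (fun x => f (h x)).
Proof.
  intros Hb Hlo. revert f h Hb Hlo.
  induction n as [|n IH]; intros f h Hb Hlo Hf0 Hh0;
    destruct (Hf0) as [Hf Hf1], (Hh0) as [Hh Hh1]; split; trivial.
  1, 2: intros x Hx; apply Hf; split; [auto|apply Hb; lra].
  destruct Hf1 as (f' & Df & Hf1), Hh1 as (h' & Dh & Hh1).
  exists (fun x => h' x * f' (h x)). split.
  - intros x Hx. apply (is_derive_comp f h); auto.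
  - apply absmon_mult; trivial. apply IH; trivial. now apply absmon_pred.
Qed.

Lemma smooth_opp b n f : absmon b b n f -> absmon b b n (fun x => - f x).
Proof.
  revert f. induction n as [|n IH]; intros f [_ H]; split; trivial; try (intros; lra).
  destruct H as (f' & Df & H). exists (fun x => - f' x). split; [|now apply IH].
  intros x Hx. now apply (is_derive_opp f), Df.
Qed.

(** Induction through (1/f)' = -f' (1/f)^2, whose right side involves [/ f] only to the lower
    order. *)
Lemma smooth_inv b n f :
  (forall x, x < b -> f x <> 0) -> absmon b b n f -> absmon b b n (fun x => / f x).
Proof.
  intros H0. induction n as [|n IH]; intros Hf; split; trivial; try (intros; lra).
  destruct (Hf) as [_ (f' & Df & Hf1)].
  exists (fun x => (- f' x) * (/ f x * / f x)). split.
  - intros x Hx. evar_last; [apply is_derive_inv; auto|]. field. auto.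
  - apply absmon_pred in Hf.
    apply absmon_mult; [now apply smooth_opp|]. apply absmon_mult; now apply IH.
Qed.

Lemma absmon_Derive_n lo b n f :
  absmon lo b n f -> forall k x, (k <= n)%nat -> x < b ->
  (lo <= x -> 0 <= Derive_n f k x) /\
  ((k < n)%nat -> is_derive (Derive_n f k) x (Derive_n f (S k) x)).
Proof.
  revert f. induction n as [|n IH]; intros f [Hf Hf1] k x Hk Hx.
  - replace k with O by lia. split; [intros; apply Hf; lra|lia].
  - destruct Hf1 as (f' & Df & Hf1).
    (* [Derive_n] adds derivatives on the outside, whereas [absmon] peels off the innermost one; [E]
       exchanges the two orders. *)
    assert (E : forall j y, y < b -> Derive_n f (S j) y = Derive_n f' j y).
    { intros j y Hy. replace (S j) with (j + 1)%nat by lia. rewrite <- Derive_n_comp.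
      apply Derive_n_ext_loc. apply (open_lt b y) in Hy. revert Hy.
      apply filter_imp. intros t Ht. now apply is_derive_unique, Df. }
    destruct k as [|k].
    + split; [intros; apply Hf; lra|]. intros _. rewrite E by trivial. now apply Df.
    + specialize (IH f' Hf1 k x ltac:(lia) Hx). rewrite !E by trivial. split; [apply IH|].
      intros Hk'. apply is_derive_ext_loc with (Derive_n f' k).
      * apply (open_lt b x) in Hx. revert Hx. apply filter_imp. intros t Ht. now rewrite E.
      * apply IH. lia.
Qed.

(** * Bernstein's theorem *)

Section Bernstein.

Variables (b : R) (D : nat -> R -> R).
Hypothesis D_derive : forall n x, x < b -> is_derive (D n) x (D (S n) x).
Hypothesis D_nonneg : forall n x, 0 <= x < b -> 0 <= D n x.

Let T (n k : nat) (x : R) : R := sum_n (fun i => D (i + k) 0 / INR (fact i) * x ^ i) n.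

(** Here [n] counts the Taylor terms removed from [D k]. Differentiation then turns the indices
    [S n], [k] into [n], [S k], ending at a plain [D]. *)
Definition taylor_rem (n k : nat) (x : R) : R :=
  match n with O => D k x | S m => D k x - T m k x end.

Lemma taylor_poly_derive n k x : is_derive (T (S n) k) x (T n (S k) x).
Proof.
  unfold T.
  evar_last.
  { apply (is_derive_sum_n (fun i y => D (i + k) 0 / INR (fact i) * y ^ i) (S n) x
      (fun i => D (i + k) 0 / INR (fact i) * (INR i * x ^ pred i))).
    intros i _. auto_derive; trivial. ring. }
  unfold sum_n at 1. rewrite sum_Sn_m by lia. rewrite <- sum_n_m_S.
  unfold plus; simpl plus. change (INR 0) with 0.
  rewrite Rmult_0_l, Rmult_0_r, Rplus_0_l.
  apply sum_n_m_ext. intros i. cbn [pred].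
  replace (S i + k)%nat with (i + S k)%nat by lia.
  rewrite fact_simpl, mult_INR.
  match goal with |- ?l = ?r => change (l = r :> R) end. field.
  split; [apply INR_fact_neq_0|apply not_0_INR; lia].
Qed.

Lemma taylor_rem_derive n k x :
  x < b -> is_derive (taylor_rem (S n) k) x (taylor_rem n (S k) x).
Proof.
  intros Hx. destruct n as [|n].
  - apply is_derive_ext with (fun y => D k y - D k 0).
    + intros t. unfold taylor_rem, T. rewrite sum_O. cbn. field.
    + evar_last; [|apply Rminus_0_r].
      apply (is_derive_minus (D k) (fun _ => D k 0)); [now apply D_derive|].
      apply (is_derive_const (D k 0)).
  - apply (is_derive_minus (D k)); [now apply D_derive|apply taylor_poly_derive].
Qed.

Lemma taylor_rem_0 n k : taylor_rem (S n) k 0 = 0.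
Proof.
  unfold taylor_rem, T, sum_n. rewrite sum_Sn_m by lia.
  rewrite (sum_n_m_ext_loc _ (fun _ => zero)).
  - rewrite sum_n_m_const_zero. unfold plus, zero; cbn. field.
  - intros i Hi. rewrite pow_i by lia. apply Rmult_0_r.
Qed.

(** Each remainder with [n > 0] vanishes at 0 and has as derivative a remainder of lower index, so
    nonnegativity climbs up from [D]. *)
Lemma taylor_rem_nonneg n k x : 0 <= x < b -> 0 <= taylor_rem n k x.
Proof.
  revert k x. induction n as [|n IH]; intros k x Hx; [now apply D_nonneg|].
  rewrite <- (taylor_rem_0 n k).
  apply derive_nonneg_le with (taylor_rem n (S k)); [lra| |].
  - intros t Ht. apply taylor_rem_derive. lra.
  - intros t Ht. apply IH. lra.
Qed.

Lemma taylor_rem_le n k x : 0 <= x < b -> taylor_rem n k x <= D k x.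
Proof.
  intros Hx. destruct n as [|n]; [apply Rle_refl|]. unfold taylor_rem.
  enough (0 <= T n k x) by lra. unfold T.
  assert (H : forall i, 0 <= D (i + k) 0 / INR (fact i) * x ^ i).
  { intros i. apply Rmult_le_pos; [|apply pow_le; lra].
    apply Rdiv_le_0_compat; [apply D_nonneg; lra|apply INR_fact_lt_0]. }
  induction n as [|n IHn]; [rewrite sum_O; apply H|].
  rewrite sum_Sn. apply Rplus_le_le_0_compat; auto.
Qed.

(* That is, [taylor_rem n k x / x ^ n] is nondecreasing in [x]. *)
Lemma taylor_rem_scale n k l y :
  0 <= l <= 1 -> 0 <= y < b -> taylor_rem n k (l * y) <= l ^ n * taylor_rem n k y.
Proof.
  intros Hl. revert k y. induction n as [|n IH]; intros k y Hy.
  - cbn. rewrite Rmult_1_l.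
    apply derive_nonneg_le with (D (S k)); [nra| |].
    + intros t Ht. apply D_derive. nra.
    + intros t Ht. apply D_nonneg. nra.
  (* [K] vanishes at 0, and its derivative is [l] times the difference that the induction hypothesis
     makes nonnegative. *)
  - pose (K := fun t => l ^ S n * taylor_rem (S n) k t - taylor_rem (S n) k (l * t)).
    enough (H : K 0 <= K y).
    { unfold K in H. rewrite Rmult_0_r, taylor_rem_0 in H. lra. }
    apply derive_nonneg_le with
      (fun t => l ^ S n * taylor_rem n (S k) t - l * taylor_rem n (S k) (l * t)); [lra| |].
    + intros t Ht. unfold K.
      apply (is_derive_minus (fun t => l ^ S n * taylor_rem (S n) k t)
               (fun t => taylor_rem (S n) k (l * t))).
      * apply is_derive_scal. apply taylor_rem_derive. lra.
      * apply (is_derive_comp (taylor_rem (S n) k) (fun t => l * t)).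
        -- apply taylor_rem_derive. nra.
        -- auto_derive; trivial. ring.
    + intros t Ht. specialize (IH (S k) t ltac:(lra)). cbn [pow]. nra.
Qed.

(** For [y] strictly between [x] and [b] and [l = x / y < 1], scaling bounds the remainder at [x] by
    [l ^ S n * D 0 y], which tends to 0. *)
Theorem bernstein x :
  0 <= x < b -> is_lim_seq (sum_n (fun i => D i 0 / INR (fact i) * x ^ i)) (D 0 x).
Proof.
  intros Hx.
  pose (y := (x + b) / 2). pose (l := x / y).
  assert (Hy : x < y < b) by (unfold y; lra).
  assert (Hl : 0 <= l < 1).
  { unfold l. split; [apply Rdiv_le_0_compat; lra|]. apply Rlt_div_l; lra. }
  assert (Hxl : x = l * y) by (unfold l; field; lra).
  apply is_lim_seq_ext with (fun n => D 0 x - taylor_rem (S n) 0 x).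
  { intros n. unfold taylor_rem, T. ring_simplify. apply sum_n_ext. intros i.
    now rewrite Nat.add_0_r. }
  evar_last.
  - apply is_lim_seq_minus'; [apply is_lim_seq_const|].
    apply is_lim_seq_le_le with (fun _ => 0) (fun n => l ^ S n * D 0 y).
    + intros n. split; [now apply taylor_rem_nonneg|]. rewrite Hxl at 1.
      eapply Rle_trans; [apply taylor_rem_scale; lra|].
      apply Rmult_le_compat_l; [apply pow_le; lra|]. apply taylor_rem_le. lra.
    + apply is_lim_seq_const.
    + evar_last.
      * apply is_lim_seq_mult'; [|apply is_lim_seq_const].
        apply (is_lim_seq_incr_1 (fun n => l ^ n)). apply is_lim_seq_geom.
        rewrite Rabs_pos_eq; lra.
      * now rewrite Rmult_0_l.
  - now rewrite Rminus_0_r.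
Qed.

End Bernstein.

(** * The entire function s and its derivatives *)

Lemma CV_radius_infinite (a : nat -> R) :
  (forall x, ex_pseries a x) -> CV_radius a = p_infty.
Proof.
  intros H. destruct (CV_radius a) as [r| |] eqn:E; trivial; exfalso.
  - apply (CV_disk_outside a (Rabs r + 1)).
    + rewrite E. cbn. pose proof (Rabs_pos r). pose proof (Rle_abs r).
      rewrite (Rabs_pos_eq (Rabs r + 1)); lra.
    + apply ex_series_lim_0, ex_pseries_R, H.
  - pose proof (CV_radius_ge_0 a) as H0. now rewrite E in H0.
Qed.

Lemma smooth_PSeries b n a : CV_radius a = p_infty -> absmon b b n (PSeries a).
Proof.
  revert a. induction n as [|n IH]; intros a Ha; split; trivial; try (intros; lra).
  exists (PSeries (PS_derive a)). split.
  - intros x _. apply is_derive_PSeries. now rewrite Ha.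
  - apply IH. now rewrite CV_radius_derive.
Qed.

Lemma CV_radius_sin_n : CV_radius sin_n = p_infty.
Proof.
  apply CV_radius_infinite. intros x. destruct (exist_sin x) as [l Hl].
  exists l. now apply is_pseries_Reals.
Qed.

(* The function s of the introduction, and its first two derivatives. *)
Definition sincr (u : R) : R := PSeries sin_n u.
Definition dsincr (u : R) : R := PSeries (PS_derive sin_n) u.
Definition ddsincr (u : R) : R := PSeries (PS_derive (PS_derive sin_n)) u.

Lemma sincr_derive u : is_derive sincr u (dsincr u).
Proof. apply is_derive_PSeries. now rewrite CV_radius_sin_n. Qed.

Lemma dsincr_derive u : is_derive dsincr u (ddsincr u).
Proof. apply is_derive_PSeries. now rewrite CV_radius_derive, CV_radius_sin_n. Qed.

Lemma sincr_0 : sincr 0 = 1.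
Proof. unfold sincr. rewrite PSeries_0. unfold sin_n. cbn. field. Qed.

(** By definition [sin v] is [v] times the sum of this very series at the square of [v]. *)
Lemma sincr_sqr v : v * sincr (v ^ 2) = sin v.
Proof.
  unfold sin. destruct (exist_sin v²) as [l Hl]. f_equal.
  apply is_pseries_unique, is_pseries_Reals. now rewrite <- Rsqr_pow2.
Qed.

Lemma is_pseries_alternate (c : nat -> R) x l :
  is_pseries (fun n => (-1) ^ n / c n) (- x) l -> is_pseries (fun n => / c n) x l.
Proof.
  apply is_series_ext. intros n. rewrite !pow_n_pow.
  change ((- x) ^ n * ((-1) ^ n / c n) = x ^ n * / c n).
  replace (- x) with (-1 * x) by ring. rewrite Rpow_mult_distr.
  assert (H1 : (-1) ^ n * (-1) ^ n = 1).
  { rewrite <- Rpow_mult_distr. replace (-1 * -1) with 1 by ring. apply pow1. }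
  rewrite <- (Rmult_1_l (x ^ n * / c n)), <- H1. unfold Rdiv. ring.
Qed.

Lemma sincr_neg_sqr v : v * sincr (- v ^ 2) = sinh v.
Proof.
  (* [E] is cosh, the even part of the exponential series; it cancels in [sinh], leaving the odd
     part. *)
  pose (E := fun w : R => PSeries (fun n => / INR (fact (2 * n))) (w ^ 2)).
  assert (HE : forall w, is_pseries (fun n => / INR (fact (2 * n))) (w ^ 2) (E w)).
  { intros w. apply PSeries_correct. destruct (exist_cos (- w ^ 2)) as [l Hl].
    exists l. now apply is_pseries_alternate, is_pseries_Reals. }
  assert (HO : forall w, is_pseries (fun n => / INR (fact (2 * n + 1))) (w ^ 2) (sincr (- w ^ 2))).
  { intros w. destruct (exist_sin (- w ^ 2)) as [l Hl]. apply is_pseries_Reals in Hl.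
    unfold sincr. rewrite (is_pseries_unique _ _ _ Hl). now apply is_pseries_alternate. }
  assert (Hexp : forall w, exp w = E w + w * sincr (- w ^ 2)).
  { intros w. rewrite <- (is_pseries_unique _ _ _ (is_exp_Reals w)).
    apply is_pseries_unique.
    apply (is_pseries_odd_even (fun n => / INR (fact n))); [apply HE|apply HO]. }
  unfold sinh. rewrite !Hexp. unfold E.
  replace ((- v) ^ 2) with (v ^ 2) by ring. field.
Qed.

(** Compared coefficientwise, the equation is the recurrence (2n+2)(2n+3) c(n+1) = -c(n) of the
    coefficients [sin_n]. *)
Lemma sincr_ode u : 4 * u * ddsincr u + 6 * dsincr u + sincr u = 0.
Proof.
  assert (H0 := CV_radius_sin_n).
  assert (H1 := H0). rewrite <- CV_radius_derive in H1.
  assert (H2 := H1). rewrite <- CV_radius_derive in H2.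
  assert (ex : forall a, CV_radius a = p_infty -> ex_pseries a u).
  { intros a Ha. apply CV_radius_inside. now rewrite Ha. }
  assert (exi : forall a : nat -> R, CV_radius a = p_infty -> ex_pseries (PS_incr_1 a) u).
  { intros a Ha. apply ex_pseries_incr_1; trivial. auto. }
  assert (exs : forall (c : R) (a : nat -> R), ex_pseries a u -> ex_pseries (PS_scal c a) u).
  { intros c a Ha. apply ex_pseries_scal; trivial. apply Rmult_comm. }
  transitivity (PSeries (PS_plus (PS_plus (PS_scal 4 (PS_incr_1 (PS_derive (PS_derive sin_n))))
     (PS_scal 6 (PS_derive sin_n))) sin_n) u).
  - rewrite !PSeries_plus, !PSeries_scal, PSeries_incr_1; auto.
    + unfold ddsincr, dsincr, sincr. ring.
    + apply ex_pseries_plus; auto.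
  - rewrite <- (PSeries_const_0 u). apply PSeries_ext. intros n.
    unfold PS_plus, PS_scal, PS_incr_1, PS_derive, plus, scal; cbn -[INR sin_n].
    unfold mult; cbn -[INR sin_n].
    assert (E : forall k, sin_n (S k) = - sin_n k / ((2 * INR k + 2) * (2 * INR k + 3))).
    { intros k. unfold sin_n.
      replace (2 * S k + 1)%nat with (S (S (2 * k + 1))) by lia.
      rewrite !fact_simpl, !mult_INR, !S_INR, plus_INR, mult_INR. cbn [pow INR].
      pose proof (pos_INR k). field. split; [apply INR_fact_neq_0|lra]. }
    destruct n as [|n].
    + rewrite E. unfold zero; cbn. field.
    + rewrite (E (S n)), !S_INR. pose proof (pos_INR n). field. lra.
Qed.

Lemma sincr_sqr_derive v : sincr (v ^ 2) + 2 * v ^ 2 * dsincr (v ^ 2) = cos v.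
Proof.
  rewrite <- (is_derive_unique sin v (cos v)) by apply is_derive_Reals, derivable_pt_lim_sin.
  symmetry. apply is_derive_unique.
  apply is_derive_ext with (fun t => t * sincr (t ^ 2)); [apply sincr_sqr|].
  evar_last.
  - apply (is_derive_mult (fun t => t) (fun t => sincr (t ^ 2)));
      [apply is_derive_id| |exact Rmult_comm].
    apply (is_derive_comp sincr (fun t => t ^ 2)); [apply sincr_derive|].
    auto_derive; trivial.
  - unfold plus, mult, scal, one; cbn. unfold mult; cbn. ring.
Qed.

Lemma sincr_neg_sqr_derive v : sincr (- v ^ 2) - 2 * v ^ 2 * dsincr (- v ^ 2) = cosh v.
Proof.
  rewrite <- (is_derive_unique sinh v (cosh v)) by apply is_derive_Reals, derivable_pt_lim_sinh.
  symmetry. apply is_derive_unique.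
  apply is_derive_ext with (fun t => t * sincr (- t ^ 2)); [apply sincr_neg_sqr|].
  evar_last.
  - apply (is_derive_mult (fun t => t) (fun t => sincr (- t ^ 2)));
      [apply is_derive_id| |exact Rmult_comm].
    apply (is_derive_comp sincr (fun t => - t ^ 2)); [apply sincr_derive|].
    auto_derive; trivial.
  - unfold plus, mult, scal, one; cbn. unfold mult; cbn. ring.
Qed.

(** * Signs of s, s' and s'' below [PI ^ 2] *)

Lemma signed_square (u : R) : exists e v, 0 <= v /\ (e = 1 \/ e = -1) /\ u = e * v ^ 2.
Proof.
  destruct (Rle_or_lt 0 u).
  - exists 1, (sqrt u). split; [apply sqrt_pos|]. split; [now left|]. rewrite pow2_sqrt; lra.
  - exists (-1), (sqrt (- u)). split; [apply sqrt_pos|]. split; [now right|].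
    rewrite pow2_sqrt; lra.
Qed.

Lemma sincr_pos u : u < PI ^ 2 -> 0 < sincr u.
Proof.
  intros Hu. destruct (signed_square u) as (e & v & [Hv| <-] & He & ->).
  2: { replace (e * 0 ^ 2) with 0 by ring. rewrite sincr_0. lra. }
  apply Rmult_lt_reg_l with v; trivial. rewrite Rmult_0_r.
  pose proof PI_RGT_0. destruct He as [-> | ->].
  - rewrite Rmult_1_l in *. rewrite sincr_sqr. apply sin_gt_0; nra.
  - replace (-1 * v ^ 2) with (- v ^ 2) by ring. rewrite sincr_neg_sqr.
    rewrite <- sinh_0. now apply sinh_lt.
Qed.

(* The mean value theorem for [t ^ S d * h (e * t ^ 2)] on [[0, v]]. *)
Lemma euler_operator_MVT (h h' : R -> R) (d : nat) (e v : R) :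
  0 < v -> (forall t, 0 <= t <= v -> is_derive h (e * t ^ 2) (h' (e * t ^ 2))) ->
  exists t, 0 < t < v /\
    v ^ d * h (e * v ^ 2) =
    t ^ d * (INR (S d) * h (e * t ^ 2) + 2 * (e * t ^ 2) * h' (e * t ^ 2)).
Proof.
  intros Hv Hd.
  destruct (derive_MVT (fun t => t ^ S d * h (e * t ^ 2))
    (fun t => t ^ d * (INR (S d) * h (e * t ^ 2) + 2 * (e * t ^ 2) * h' (e * t ^ 2))) 0 v Hv)
    as (t & E & Ht).
  - intros t Ht. evar_last.
    + apply (is_derive_mult (fun t => t ^ S d) (fun t => h (e * t ^ 2))); [| |exact Rmult_comm].
      * apply is_derive_Reals, derivable_pt_lim_pow.
      * apply (is_derive_comp h (fun t => e * t ^ 2)); [apply Hd; lra|]. auto_derive; trivial.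
    + unfold plus, mult, scal; cbn -[INR]. unfold mult; cbn -[INR]. ring.
  - exists t. split; trivial. cbn [pow] in E. cbn [pow].
    apply Rmult_eq_reg_l with v; lra.
Qed.

(** Along x = e t^2 the hypothesis says that t^(d+1) h(e t^2), which is 0 at t = 0, has positive
    derivative for t > 0. At x = 0 it reads (d+1) h(0) > 0. *)
Lemma euler_operator_pos (b : R) (h h' : R -> R) (d : nat) :
  0 < b -> (forall x, x < b -> is_derive h x (h' x)) ->
  (forall x, x < b -> 0 < INR (S d) * h x + 2 * x * h' x) ->
  forall x, x < b -> 0 < h x.
Proof.
  intros Hb Hd Hp x Hx. destruct (signed_square x) as (e & v & [Hv| <-] & He & ->).
  - assert (He' : forall t, 0 <= t <= v -> e * t ^ 2 < b).
    { intros t Ht. assert (0 <= t ^ 2 <= v ^ 2) by nra. destruct He as [-> | ->]; nra. }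
    destruct (euler_operator_MVT h h' d e v Hv) as (t & Ht & E); [auto|].
    specialize (Hp (e * t ^ 2)).
    assert (H1 : 0 < t ^ d) by (apply pow_lt; lra).
    assert (H2 : 0 < v ^ d) by (apply pow_lt; lra).
    apply Rmult_lt_reg_l with (v ^ d); trivial. rewrite Rmult_0_r, E.
    apply Rmult_lt_0_compat; trivial. apply Hp, He'. lra.
  - replace (e * 0 ^ 2) with 0 in * by ring. specialize (Hp 0 Hb).
    pose proof (lt_0_INR (S d) ltac:(lia)). nra.
Qed.

Definition dddsincr (u : R) : R := PSeries (PS_derive (PS_derive (PS_derive sin_n))) u.

Lemma ddsincr_derive u : is_derive ddsincr u (dddsincr u).
Proof. apply is_derive_PSeries. now rewrite !CV_radius_derive, CV_radius_sin_n. Qed.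

Lemma sincr_ode_derive u : 4 * u * dddsincr u + 10 * ddsincr u + dsincr u = 0.
Proof.
  transitivity (Derive (fun u => 4 * u * ddsincr u + 6 * dsincr u + sincr u) u).
  - symmetry. apply is_derive_unique. evar_last.
    + apply (is_derive_plus (fun u => 4 * u * ddsincr u + 6 * dsincr u) sincr);
        [|apply sincr_derive].
      apply (is_derive_plus (fun u => 4 * u * ddsincr u) (fun u => 6 * dsincr u));
        [|apply is_derive_scal, dsincr_derive].
      apply (is_derive_mult (fun u => 4 * u) ddsincr); [|apply ddsincr_derive|exact Rmult_comm].
      apply is_derive_scal, is_derive_id.
    + unfold plus, mult, one; cbn -[sincr dsincr ddsincr dddsincr]. ring.
  - rewrite (Derive_ext _ (fun _ => 0)) by apply sincr_ode. apply Derive_const.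
Qed.

Lemma PI_sqr_pos : 0 < PI ^ 2.
Proof. apply pow_lt, PI_RGT_0. Qed.

(** The differential equation reads 3(-s') + 2u(-s'') = s/2, so positivity passes from s to -s'. *)
Lemma dsincr_neg u : u < PI ^ 2 -> dsincr u < 0.
Proof.
  intros Hu. enough (0 < - dsincr u) by lra. revert u Hu.
  apply euler_operator_pos with (h' := fun u => - ddsincr u) (d := 2%nat);
    [apply PI_sqr_pos| |].
  - intros u _. apply (is_derive_opp dsincr), dsincr_derive.
  - intros u Hu. apply sincr_pos in Hu. pose proof (sincr_ode u). cbn [INR]. lra.
Qed.

(** The differentiated equation reads 5s'' + 2u s''' = -s'/2, so positivity passes on to s''. *)
Lemma ddsincr_pos u : u < PI ^ 2 -> 0 < ddsincr u.
Proof.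
  revert u.
  apply euler_operator_pos with (h' := dddsincr) (d := 4%nat); [apply PI_sqr_pos| |].
  - intros u _. apply ddsincr_derive.
  - intros u Hu. apply dsincr_neg in Hu. pose proof (sincr_ode_derive u). cbn [INR]. lra.
Qed.

Lemma absmon_id b n : absmon 0 b n (fun x => x).
Proof.
  destruct n as [|n]; (split; [intros; lra|]); trivial.
  exists (fun _ => 1). split; [intros x _; apply (is_derive_id x)|]. apply absmon_const; lra.
Qed.

(** * Absolute monotonicity of [- s'' / s'] *)

(* [W] is an integrating factor: [2 x (W f)' + (d + 1) W f = W r]. *)
Lemma ode_nonneg (b : R) (W m f f' r : R -> R) (d : nat) :
  (forall x, x < b -> 0 < W x) ->
  (forall x, x < b -> is_derive W x (- (m x * W x) / 2)) ->
  (forall x, x < b -> is_derive f x (f' x)) ->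
  (forall x, 0 <= x < b -> 0 <= r x) ->
  (forall x, x < b -> 2 * x * f' x + INR (S d) * f x = x * m x * f x + r x) ->
  forall x, 0 <= x < b -> 0 <= f x.
Proof.
  intros HW HdW Hf Hr E x Hx.
  destruct (signed_square x) as (e & v & [Hv| <-] & He & ->).
  - assert (e = 1) as -> by nra.
    assert (Hb : forall t, 0 <= t <= v -> 0 <= 1 * t ^ 2 < b) by (intros; nra).
    destruct (euler_operator_MVT (fun x => W x * f x)
      (fun x => - (m x * W x) / 2 * f x + W x * f' x) d 1 v Hv) as (t & Ht & E').
    + intros t Ht. apply (is_derive_mult W f); [apply HdW|apply Hf|exact Rmult_comm];
        now apply Hb.
    + specialize (Hb t ltac:(lra)).
      apply Rmult_le_reg_l with (v ^ d * W (1 * v ^ 2)).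
      * apply Rmult_lt_0_compat; [apply pow_lt; lra|apply HW; lra].
      * rewrite Rmult_0_r, Rmult_assoc, E'. apply Rmult_le_pos; [apply pow_le; lra|].
        replace (_ + _) with (W (1 * t ^ 2) * r (1 * t ^ 2)).
        -- apply Rmult_le_pos; [apply Rlt_le, HW; lra|now apply Hr].
        -- specialize (E (1 * t ^ 2) ltac:(lra)). nra.
  (* At the singular point the equation degenerates to (d+1) f(0) = r(0). *)
  - replace (e * 0 ^ 2) with 0 in * by ring.
    specialize (E 0 ltac:(lra)). specialize (Hr 0 Hx).
    pose proof (lt_0_INR (S d) ltac:(lia)). nra.
Qed.

(* Differentiating the equation reproduces its shape with [d + 2] in place of [d]. *)
Lemma ode_absmon (b : R) (W m : R -> R) (n : nat) :
  (forall x, x < b -> 0 < W x) ->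
  (forall x, x < b -> is_derive W x (- (m x * W x) / 2)) ->
  absmon 0 b n m ->
  forall (f f' r : R -> R) (d : nat),
  (forall x, x < b -> is_derive f x (f' x)) -> absmon b b n f' -> absmon 0 b n r ->
  (forall x, x < b -> 2 * x * f' x + INR (S d) * f x = x * m x * f x + r x) ->
  absmon 0 b n f.
Proof.
  intros HW HdW. induction n as [|n IH]; intros Hm f f' r d Hf Hs Hr E;
    assert (H0 : forall x, 0 <= x < b -> 0 <= f x)
      by (apply ode_nonneg with W m f' r d; trivial; apply Hr).
  - split; trivial.
  - split; trivial. exists f'. split; trivial.
    assert (Hfn : absmon 0 b n f).
    { apply IH with f' r d; trivial; now apply absmon_pred. }
    destruct (Hm) as [_ (m' & Dm & Hm')], (Hr) as [_ (r' & Dr & Hr')],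
      (Hs) as [_ (f'' & Df & Hs')].
    (* The new source contains [f] itself, but only to order [n], which [Hfn] supplies; all its
       coefficients are absolutely monotone. *)
    apply IH with f'' (fun x => m x * f x + x * (m' x * f x) + r' x) (S (S d));
      trivial; try now apply absmon_pred.
    + repeat apply absmon_plus; trivial; repeat apply absmon_mult; trivial;
        try apply absmon_id; now apply absmon_pred.
    + intros x Hx.
      assert (D1 : is_derive (fun x => 2 * x * f' x + INR (S d) * f x) x
                (2 * x * f'' x + (INR (S d) + 2) * f' x)).
      { evar_last.
        - apply (is_derive_plus (fun x => 2 * x * f' x) (fun x => INR (S d) * f x)).
          + apply (is_derive_mult (fun x => 2 * x) f'); [|now apply Df|exact Rmult_comm].
            apply is_derive_scal, is_derive_id.
          + apply is_derive_scal. now apply Hf.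
        - unfold plus, mult, scal, one; cbn -[INR]. ring. }
      assert (D2 : is_derive (fun x => x * m x * f x + r x) x
                (m x * f x + x * m' x * f x + x * m x * f' x + r' x)).
      { evar_last.
        - apply (is_derive_plus (fun x => x * m x * f x) r); [|now apply Dr].
          apply (is_derive_mult (fun x => x * m x) f); [|now apply Hf|exact Rmult_comm].
          apply (is_derive_mult (fun x => x) m); [apply is_derive_id|now apply Dm|exact Rmult_comm].
        - unfold plus, mult, scal, one; cbn. ring. }
      rewrite (S_INR (S (S d))), (S_INR (S d)).
      pose proof (is_derive_unique_below b _ _ x _ _ E Hx D1 D2). lra.
Qed.

(* The function p of the introduction, [- (ln (- s'))']. *)
Definition plog (u : R) : R := ddsincr u / - dsincr u.
Definition dplog (u : R) : R := dddsincr u / - dsincr u + plog u ^ 2.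

Lemma plog_derive u : u < PI ^ 2 -> is_derive plog u (dplog u).
Proof.
  intros Hu. apply dsincr_neg in Hu. evar_last.
  - apply (is_derive_div ddsincr (fun u => - dsincr u)); [apply ddsincr_derive| |lra].
    apply (is_derive_opp dsincr), dsincr_derive.
  - unfold dplog, plog, opp; cbn. field. lra.
Qed.

(** This is the differentiated equation of s divided by -2s', with s'''/(-s') = p' - p^2. *)
Lemma plog_riccati u :
  u < PI ^ 2 -> 2 * u * dplog u + 5 * plog u = 2 * u * plog u ^ 2 + 1 / 2.
Proof.
  intros Hu. apply dsincr_neg in Hu. unfold dplog.
  assert (E : 2 * u * dddsincr u = - 5 * ddsincr u - dsincr u / 2)
    by (pose proof (sincr_ode_derive u); lra).
  replace (2 * u * (dddsincr u / - dsincr u + plog u ^ 2))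
    with ((2 * u * dddsincr u) / - dsincr u + 2 * u * plog u ^ 2) by (field; lra).
  rewrite E. unfold plog. field. lra.
Qed.

(** Differentiating the Riccati equation gives 2u p'' + 7p' = 4u p p' + 2p^2, linear in p'. Its
    coefficient and source involve p alone, so order [n] for p yields order [n] for p', hence order
    [S n] for p. *)
Lemma plog_absmon n : absmon 0 (PI ^ 2) n plog.
Proof.
  (* Differentiability to every order, without signs, holds because s' has no zero below
     [PI ^ 2]. *)
  assert (Hsm : forall k, absmon (PI ^ 2) (PI ^ 2) k plog).
  { intros k. apply absmon_mult.
    - apply smooth_PSeries. now rewrite !CV_radius_derive, CV_radius_sin_n.
    - apply smooth_inv with (f := fun u => - dsincr u).
      + intros u Hu. apply dsincr_neg in Hu. lra.
      + apply smooth_opp, smooth_PSeries. now rewrite !CV_radius_derive, CV_radius_sin_n. }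
  assert (Hp : forall u, 0 <= u < PI ^ 2 -> 0 <= plog u).
  { intros u Hu. pose proof (dsincr_neg u ltac:(lra)). pose proof (ddsincr_pos u ltac:(lra)).
    apply Rdiv_le_0_compat; lra. }
  induction n as [|n IH]; split; trivial.
  exists dplog. split; [apply plog_derive|].
  assert (Hsd : absmon (PI ^ 2) (PI ^ 2) (S n) dplog).
  { apply absmon_derive with plog; [apply plog_derive|apply Hsm]. }
  destruct (Hsd) as [_ (p2 & Dp2 & Hp2)].
  (* The integrating factor is (s')^2, since its derivative 2s's'' equals -2p (s')^2; and [d = 6]
     encodes the coefficient 7. *)
  apply ode_absmon with (W := fun u => dsincr u ^ 2) (m := fun u => 4 * plog u)
    (f' := p2) (r := fun u => 2 * (plog u * plog u)) (d := 6%nat); trivial.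
  - intros u Hu. apply dsincr_neg in Hu. nra.
  - intros u Hu. apply dsincr_neg in Hu. evar_last.
    + apply (is_derive_pow dsincr 2), dsincr_derive.
    + unfold plog. cbn. field. lra.
  - apply absmon_mult; trivial. apply absmon_const. lra.
  - apply absmon_mult; [apply absmon_const; lra|]. now apply absmon_mult.
  - intros u Hu.
    assert (D1 : is_derive (fun u => 2 * u * dplog u + 5 * plog u) u
                (2 * u * p2 u + 7 * dplog u)).
    { evar_last.
      - apply (is_derive_plus (fun u => 2 * u * dplog u) (fun u => 5 * plog u)).
        + apply (is_derive_mult (fun u => 2 * u) dplog); [|now apply Dp2|exact Rmult_comm].
          apply is_derive_scal, is_derive_id.
        + apply is_derive_scal. now apply plog_derive.
      - unfold plus, mult, scal, one; cbn. ring. }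
    assert (D2 : is_derive (fun u => 2 * u * plog u ^ 2 + 1 / 2) u
              (2 * plog u ^ 2 + 4 * u * plog u * dplog u)).
    { evar_last.
      - apply (is_derive_plus (fun u => 2 * u * plog u ^ 2) (fun u => 1 / 2));
          [|apply is_derive_const].
        apply (is_derive_mult (fun u => 2 * u) (fun u => plog u ^ 2)); [| |exact Rmult_comm].
        + apply is_derive_scal, is_derive_id.
        + apply (is_derive_pow plog 2). now apply plog_derive.
      - unfold plus, mult, scal, one, zero; cbn. ring. }
    pose proof (is_derive_unique_below _ _ _ u _ _ plog_riccati Hu D1 D2). cbn [INR]. lra.
Qed.

(* The function Phi of the introduction, the derivative of the inverse of [1 - sincr]. *)
Definition dinv (u : R) : R := / - dsincr u.

(** Induction through Phi' = p Phi. *)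
Lemma dinv_absmon n : absmon 0 (PI ^ 2) n dinv.
Proof.
  assert (Hp : forall u, 0 <= u < PI ^ 2 -> 0 <= dinv u).
  { intros u Hu. pose proof (dsincr_neg u ltac:(lra)).
    apply Rlt_le, Rinv_0_lt_compat. lra. }
  induction n as [|n IH]; split; trivial.
  exists (fun u => plog u * dinv u). split.
  - intros u Hu. apply dsincr_neg in Hu. evar_last.
    + apply (is_derive_inv (fun u => - dsincr u)); [|lra].
      apply (is_derive_opp dsincr), dsincr_derive.
    + unfold plog, dinv, opp; cbn. field. lra.
  - apply absmon_mult; trivial. apply plog_absmon.
Qed.

(** * The inverse of [1 - sincr] and the function [F] *)

(** The three branches of [g] are restrictions of one entire function. *)
Lemma g_sincr r : g r = sincr (- r).
Proof.
  unfold g. destruct (Rlt_dec 0 r) as [H|H]; [|destruct (Req_EM_T r 0) as [->|H']].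
  - pose proof (sqrt_lt_R0 r H) as Hs.
    rewrite <- sincr_neg_sqr, pow2_sqrt by lra. field. lra.
  - now rewrite Ropp_0, sincr_0.
  - pose proof (sqrt_lt_R0 (- r) ltac:(lra)) as Hs.
    rewrite <- sincr_sqr, pow2_sqrt by lra. field. lra.
Qed.

Lemma sincr_decreasing u v : u < v -> v < PI ^ 2 -> sincr v < sincr u.
Proof.
  intros Huv Hv.
  destruct (derive_MVT sincr dsincr u v Huv) as (c & E & Hc).
  - intros t _. apply sincr_derive.
  - pose proof (dsincr_neg c ltac:(lra)). nra.
Qed.

Lemma sincr_inj u v : u < PI ^ 2 -> v < PI ^ 2 -> sincr u = sincr v -> u = v.
Proof.
  intros Hu Hv E. destruct (Rtotal_order u v) as [H|[H|H]]; trivial;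
    apply sincr_decreasing in H; lra.
Qed.

Lemma sincr_continuity : continuity sincr.
Proof.
  intros u. apply derivable_continuous_pt. exists (dsincr u).
  apply is_derive_Reals, sincr_derive.
Qed.

Lemma sincr_surj y : 0 < y -> exists u, u < PI ^ 2 /\ sincr u = y.
Proof.
  (* From exp v >= (1 + v/2)^2 and exp(-v) < 1 one gets sinh v >= v^2/8, which is y v for this
     [v]. *)
  intros Hy. pose (v := 8 * y).
  assert (Hpi : sincr (PI ^ 2) = 0).
  { pose proof PI_RGT_0. apply Rmult_eq_reg_l with PI; [|lra].
    rewrite sincr_sqr, sin_PI. ring. }
  assert (Hv : y <= sincr (- v ^ 2)).
  { apply Rmult_le_reg_l with v; [unfold v; lra|]. rewrite sincr_neg_sqr.
    unfold sinh. pose proof (exp_ineq1_le (v / 2)) as H1.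
    pose proof (exp_increasing (- v) 0 ltac:(unfold v; lra)) as H2. rewrite exp_0 in H2.
    replace (exp v) with (exp (v / 2) * exp (v / 2)) by (rewrite <- exp_plus; f_equal; field).
    unfold v in *. nra. }
  destruct (IVT_gen sincr (- v ^ 2) (PI ^ 2) y sincr_continuity) as (u & Hu & E).
  - rewrite Hpi, Rmin_right, Rmax_left; lra.
  - exists u. split; trivial.
    rewrite Rmax_right in Hu by (pose proof PI_sqr_pos; unfold v; nra).
    (* The endpoint [PI ^ 2] is excluded because [sincr] vanishes there while [y > 0]. *)
    destruct (proj2 Hu) as [H| ->]; lra.
Qed.

(** The function u(xi) of the introduction. *)
Definition sinv (x : R) : R := - ginv (1 - x).

(** Surjectivity of [sincr] makes the predicate in [ginv] satisfiable, so [epsilon] returns a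
    genuine root. *)
Lemma sinv_spec x : x < 1 -> sinv x < PI ^ 2 /\ sincr (sinv x) = 1 - x.
Proof.
  intros Hx. unfold sinv, ginv.
  match goal with |- context [epsilon ?i ?P] => destruct (epsilon_spec i P) as [H1 H2] end.
  - destruct (sincr_surj (1 - x)) as (u & Hu & E); [lra|].
    exists (- u). rewrite g_sincr, Ropp_involutive. split; [lra|trivial].
  - rewrite g_sincr in H2. split; [lra|trivial].
Qed.

Lemma sinv_sincr u : u < PI ^ 2 -> sinv (1 - sincr u) = u.
Proof.
  intros Hu. pose proof (sincr_pos u Hu).
  destruct (sinv_spec (1 - sincr u)) as [H1 H2]; [lra|].
  apply sincr_inj; trivial. lra.
Qed.

Lemma sinv_increasing x y : x <= y -> y < 1 -> sinv x <= sinv y.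
Proof.
  intros Hxy Hy. destruct (sinv_spec x), (sinv_spec y); try lra.
  apply Rnot_lt_le. intros H'. apply sincr_decreasing in H'; lra.
Qed.

Lemma sinv_0 : sinv 0 = 0.
Proof.
  rewrite <- (sinv_sincr 0) at 2 by apply PI_sqr_pos. rewrite sincr_0. f_equal. ring.
Qed.

Lemma sinv_nonneg x : 0 <= x < 1 -> 0 <= sinv x.
Proof. intros Hx. rewrite <- sinv_0. apply sinv_increasing; lra. Qed.

Lemma sinv_derive x : x < 1 -> is_derive sinv x (dinv (sinv x)).
Proof.
  intros Hx. pose (f := fun u => 1 - sincr u).
  assert (Df : forall u, derivable_pt_lim f u (- dsincr u)).
  { intros u. apply is_derive_Reals. unfold f. evar_last.
    - apply (is_derive_minus (fun _ => 1) sincr); [apply is_derive_const|apply sincr_derive].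
    - unfold minus, plus, zero, opp; cbn. ring. }
  destruct (sinv_spec x Hx) as [Hu E].
  assert (Hc : continuity_pt sinv x).
  (* The midpoint [ub] keeps the interval below [PI ^ 2], where [sincr] is positive and strictly
     decreasing. *)
  { pose (lb := sinv x - 1). pose (ub := (sinv x + PI ^ 2) / 2).
    apply continuity_pt_recip_interv with f lb ub; unfold lb, ub, f.
    - lra.
    - intros v w _ Hvw Hw. pose proof (sincr_decreasing v w Hvw ltac:(lra)). lra.
    - intros t _ Ht. unfold comp, id.
      pose proof (sincr_pos ((sinv x + PI ^ 2) / 2) ltac:(lra)).
      destruct (sinv_spec t); lra.
    - intros t Ht1 Ht2.
      pose proof (sincr_pos ((sinv x + PI ^ 2) / 2) ltac:(lra)).
      apply sinv_increasing in Ht1; [|lra]. apply sinv_increasing in Ht2; [|lra].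
      rewrite sinv_sincr in Ht1, Ht2 by lra. lra.
    - intros t _. apply derivable_continuous_pt. exists (- dsincr t). apply Df.
    - pose proof (sincr_decreasing (sinv x - 1) (sinv x) ltac:(lra) ltac:(lra)).
      pose proof (sincr_decreasing (sinv x) ((sinv x + PI ^ 2) / 2) ltac:(lra) ltac:(lra)).
      lra. }
  (* The window from [x - 1] to [(x + 1) / 2] surrounds [x] and stays below 1. *)
  assert (Prf : forall u, sinv (x - 1) <= u <= sinv ((x + 1) / 2) -> derivable_pt f u).
  { intros u _. exists (- dsincr u). apply Df. }
  assert (Prg : sinv (x - 1) <= sinv x <= sinv ((x + 1) / 2)).
  { split; apply sinv_increasing; lra. }
  assert (Hd : derive_pt f (sinv x) (Prf _ Prg) = - dsincr (sinv x)).
  { apply derive_pt_eq_0, Df. }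
  pose proof (dsincr_neg _ Hu).
  apply is_derive_Reals.
  replace (dinv (sinv x)) with (1 / derive_pt f (sinv x) (Prf _ Prg))
    by (rewrite Hd; unfold dinv; field; lra).
  apply derivable_pt_lim_recip_interv; trivial; try lra.
  intros t Ht. unfold comp, f, id. destruct (sinv_spec t); lra.
Qed.

(** Bootstrapping through u' = Phi(u): order [n] for u gives order [n] for Phi(u), hence order [S n]
    for u. *)
Lemma sinv_absmon n : absmon 0 1 n sinv.
Proof.
  induction n as [|n IH]; (split; [exact sinv_nonneg|]); trivial.
  exists (fun x => dinv (sinv x)). split; [exact sinv_derive|].
  apply absmon_comp with 0 (PI ^ 2); trivial.
  - intros x Hx. now apply sinv_spec.
  - exact sinv_nonneg.
  - apply dinv_absmon.
Qed.

(* [cosr (v ^ 2) = cos v] and [cosr (- v ^ 2) = cosh v]. *)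
Definition cosr (u : R) : R := sincr u + 2 * u * dsincr u.

(** Unifies cos^2 + sin^2 = 1 and cosh^2 - sinh^2 = 1. *)
Lemma cosr_sincr_sqr u : cosr u ^ 2 + u * sincr u ^ 2 = 1.
Proof.
  unfold cosr. destruct (signed_square u) as (e & v & Hv & [-> | ->] & ->).
  - rewrite Rmult_1_l, sincr_sqr_derive. pose proof (sin2_cos2 v) as H.
    rewrite <- (sincr_sqr v) in H. unfold Rsqr in H. lra.
  - replace (-1 * v ^ 2) with (- v ^ 2) by ring.
    pose proof (sincr_neg_sqr v) as H1. pose proof (sincr_neg_sqr_derive v) as H2.
    replace (sincr (- v ^ 2) + 2 * - v ^ 2 * dsincr (- v ^ 2)) with (cosh v) by lra.
    replace (- v ^ 2 * sincr (- v ^ 2) ^ 2) with (- sinh v ^ 2) by (rewrite <- H1; ring).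
    assert (H : exp v * exp (- v) = 1) by (rewrite <- exp_plus, Rplus_opp_r; apply exp_0).
    unfold cosh, sinh. lra.
Qed.

(** Below [PI ^ 2], cos (sqrt u) changes sign only at u = PI^2/4, and for u < 0 it becomes a
    positive cosh. This absorbs the sign and the square root in [G]. *)
Lemma sgn_cosr u : u < PI ^ 2 -> sgn (PI ^ 2 - 4 * u) * Rabs (cosr u) = cosr u.
Proof.
  intros Hu. pose proof PI_RGT_0.
  assert (Hcos : (0 < PI ^ 2 - 4 * u -> 0 < cosr u) /\ (PI ^ 2 - 4 * u < 0 -> cosr u < 0)
            /\ (PI ^ 2 - 4 * u = 0 -> cosr u = 0)).
  { unfold cosr. destruct (signed_square u) as (e & v & Hv & [-> | ->] & ->).
    - rewrite Rmult_1_l in *. rewrite sincr_sqr_derive. repeat split; intros H'.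
      + apply cos_gt_0; nra.
      + apply cos_lt_0; nra.
      + replace v with (PI / 2) by nra. apply cos_PI2.
    - replace (-1 * v ^ 2) with (- v ^ 2) in * by ring.
      pose proof (sincr_neg_sqr_derive v).
      assert (0 < cosh v).
      { unfold cosh. pose proof (exp_pos v). pose proof (exp_pos (- v)). lra. }
      repeat split; intros H'; try lra; nra. }
  destruct Hcos as (H1 & H2 & H3). unfold sgn.
  destruct (Rlt_dec 0 (PI ^ 2 - 4 * u)) as [h|h];
    [|destruct (Rlt_dec (PI ^ 2 - 4 * u) 0) as [h'|h']].
  - rewrite Rabs_pos_eq; [ring|]. apply Rlt_le; auto.
  - rewrite Rabs_left by auto. ring.
  - rewrite H3 by lra. ring.
Qed.

Lemma F_sinv x :
  x < 1 -> F x = 2 - 2 * cosr (sinv x) - sinv x * sincr (sinv x).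
Proof.
  intros Hx. destruct (sinv_spec x Hx) as [Hu E].
  pose proof (cosr_sincr_sqr (sinv x)) as Hcs. rewrite E in *.
  unfold F, G. rewrite Rinv_inv.
  replace (ginv (1 - x)) with (- sinv x) by (unfold sinv; ring).
  replace (4 * - sinv x + PI ^ 2) with (PI ^ 2 - 4 * sinv x) by ring.
  (* The radicand is a perfect square because [cosr ^ 2 + u * (1 - x) ^ 2 = 1] at [u = sinv x]. *)
  replace ((/ (1 - x)) ^ 2 + - sinv x) with ((cosr (sinv x) / (1 - x))²).
  - rewrite sqrt_Rsqr_abs, Rabs_div, (Rabs_pos_eq (1 - x)) by lra.
    rewrite <- (sgn_cosr _ Hu) at 2. field. lra.
  - unfold Rsqr. apply Rmult_eq_reg_r with ((1 - x) ^ 2); [|nra].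
    field_simplify; [|lra|lra]. lra.
Qed.

(** The u-derivative of 2 - 2 [cosr] - u s is -(6s' + 4u s'' + s) - u s', which the differential
    equation reduces to -u s'; multiplying by Phi = -1/s' leaves u. *)
Lemma F_derive x : x < 1 -> is_derive F x (sinv x).
Proof.
  intros Hx. destruct (sinv_spec x Hx) as [Hu _].
  pose (H := fun u => 2 - 2 * cosr u - u * sincr u).
  apply is_derive_ext_loc with (fun x => H (sinv x)).
  - apply (open_lt 1 x) in Hx. revert Hx. apply filter_imp. intros t Ht.
    symmetry. now apply F_sinv.
  - evar_last.
    + apply (is_derive_comp H sinv); [|now apply sinv_derive].
      unfold H. apply (is_derive_minus (fun u => 2 - 2 * cosr u) (fun u => u * sincr u)).
      * apply (is_derive_minus (fun _ => 2)); [apply is_derive_const|].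
        apply is_derive_scal. unfold cosr. apply (is_derive_plus sincr); [apply sincr_derive|].
        apply (is_derive_mult (fun u => 2 * u) dsincr); [|apply dsincr_derive|exact Rmult_comm].
        apply is_derive_scal, is_derive_id.
      * apply (is_derive_mult (fun u => u) sincr);
          [apply is_derive_id|apply sincr_derive|exact Rmult_comm].
    + pose proof (dsincr_neg _ Hu). pose proof (sincr_ode (sinv x)).
      unfold dinv, scal, minus, plus, opp, zero, mult, one;
        cbn -[sincr dsincr ddsincr]; unfold mult; cbn -[sincr dsincr ddsincr].
      apply Rmult_eq_reg_l with (- dsincr (sinv x)); [|lra].
      rewrite <- Rmult_assoc, Rinv_r, Rmult_1_l by lra. lra.
Qed.

(** * The Taylor series of [F] and the limit *)

Lemma F_0 : F 0 = 0.
Proof. rewrite F_sinv, sinv_0 by lra. unfold cosr. rewrite sincr_0. ring. Qed.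

Lemma F_absmon n : absmon 0 1 n F.
Proof.
  assert (H0 : forall x, 0 <= x < 1 -> 0 <= F x).
  { intros x Hx. rewrite <- F_0. apply derive_nonneg_le with sinv; [lra| |].
    - intros t Ht. apply F_derive. lra.
    - intros t Ht. apply sinv_nonneg. lra. }
  destruct n as [|n]; split; trivial.
  exists sinv. split; [exact F_derive|apply sinv_absmon].
Qed.

Lemma F_taylor x : 0 <= x < 1 -> is_lim_seq (sum_n (fun n => a n * x ^ n)) (F x).
Proof.
  apply (bernstein 1 (Derive_n F)).
  - intros n y Hy. apply (absmon_Derive_n 0 1 (S n) F (F_absmon _)); trivial; lia.
  - intros n y Hy. apply (absmon_Derive_n 0 1 n F (F_absmon _)); trivial; lra.
Qed.

Theorem theorem3p2 : forall eta : R, 1 < eta ->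
  is_lim_seq
    (fun N : nat => sum_n_m (fun n : nat => a n * (eta - 1) ^ n / eta ^ (n - 1)) 2 N)
    (G eta).
Proof.
  intros eta Heta. pose (x := 1 - / eta).
  assert (Hi : 0 < / eta < 1).
  { split; [apply Rinv_0_lt_compat; lra|]. rewrite <- Rinv_1. apply Rinv_lt_contravar; lra. }
  assert (Hx : 0 <= x < 1) by (unfold x; lra).
  assert (EG : G eta = eta * F x).
  { unfold F. replace (1 - x) with (/ eta) by (unfold x; ring). rewrite Rinv_inv. field. lra. }
  assert (a0 : a 0 = 0).
  { unfold a. cbn. rewrite F_0. field. }
  assert (a1 : a 1 = 0).
  { unfold a. change (Derive F 0 / 1 = 0). rewrite (is_derive_unique F 0 0); [field|].
    rewrite <- sinv_0 at 2. apply F_derive. lra. }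
  (* The shift makes the range from 2 nonempty; [a0] and [a1] then let the sum start at 0. *)
  apply is_lim_seq_incr_n with 2%nat.
  apply is_lim_seq_ext with (fun N => eta * sum_n (fun n => a n * x ^ n) (N + 2)).
  - intros N. unfold sum_n. rewrite (sum_Sn_m _ 0), (sum_Sn_m _ 1), a0, a1 by lia.
    rewrite !Rmult_0_l. unfold plus; cbn [AbelianMonoid.plus]; cbn -[sum_n_m a].
    rewrite !Rplus_0_l. etransitivity; [symmetry; apply (sum_n_m_scal_l (V := R_ModuleSpace) eta)|].
    apply sum_n_m_ext_loc. intros k Hk.
    (* Termwise, eta x^k = (eta-1)^k / eta^(k-1); since k >= 2, the natural subtraction [k - 1] is
       not truncated. *)
    change (eta * (a k * x ^ k) = a k * (eta - 1) ^ k / eta ^ (k - 1)).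
    replace x with ((eta - 1) / eta) by (unfold x; field; lra).
    destruct k as [|k]; [lia|]. replace (S k - 1)%nat with k by lia.
    unfold Rdiv. rewrite Rpow_mult_distr, pow_inv. cbn [pow]. field.
    split; [apply pow_nonzero|]; lra.
  - rewrite EG. apply is_lim_seq_scal_l with (lu := F x).
    apply (is_lim_seq_incr_n (sum_n (fun n => a n * x ^ n)) 2). now apply F_taylor.
Qed.
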